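(* Let $a_1,a_2,a_3,b_1,b_2,b_3\in\mathbb{R}$ and let $$J=\begin{bmatrix} a_1 & b_1 & 0 \\ 0 & a_2 & b_2 \\ b_3 & 0 & a_3 \end{bmatrix}.$$ Suppose that $J$ is the Jacobian at a Hopf bifurcation from a stable equilibrium, i.e. $J$ has a pair of nonzero purely imaginary eigenvalues and a negative real eigenvalue. Then $$a_1+a_2<0,\qquad a_1+a_3<0,\qquad a_2+a_3<0,$$ and $$b_1b_2b_3<0.$$
   Context: $J$ is the general Jacobian of an ODE $\dot x_1=f_1(x_1,x_2)$, $\dot x_2=f_2(x_2,x_3)$, $\dot x_3=f_3(x_3,x_1)$ with $x_j\in\mathbb{R}$ (the 3-node fully inhomogeneous unidirectional ring). The condition that $J$ has nonzero purely imaginary eigenvalues and a negative real eigenvalue is equivalent to the three conditions $(a_1+a_2)(a_1+a_3)(a_2+a_3)=b_1b_2b_3$, $a_1+a_2+a_3<0$, and $a_1a_2+a_1a_3+a_2a_3>0$. *)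

(* Defs.v *)
From HB Require Import structures.
From mathcomp Require Import all_boot all_order all_algebra.
From mathcomp Require Import complex reals.

Set Implicit Arguments.
Unset Strict Implicit.
Unset Printing Implicit Defensive.

Import Order.TTheory GRing.Theory Num.Theory.
Local Open Scope ring_scope.
Local Open Scope complex_scope.

Definition ring3_jacobian (R : realType) (a1 a2 a3 b1 b2 b3 : R) : 'M[R]_3 :=
  \matrix_(i < 3, j < 3)
    nth 0 (nth [::] [:: [:: a1; b1; 0 ];
                        [:: 0 ; a2; b2];
                        [:: b3; 0 ; a3] ] i) j.

(* [eigenvalue] only sees eigenvalues in the coefficient field, so the real
   matrix is first mapped into R[i]. *)
Definition complex_eigenvalue (R : realType) (n : nat) (J : 'M[R]_n)
    (z : R[i]) : Prop :=
  eigenvalue (map_mx (real_complex R) J) z.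

(* For a 3 x 3 matrix the three eigenvalues below are distinct, hence they are
   the whole spectrum; in higher dimension one would also have to constrain
   the remaining eigenvalues. *)
Definition hopf_from_stable (R : realType) (J : 'M[R]_3) : Prop :=
  (exists2 w : R, w != 0 &
     complex_eigenvalue J (0 +i* w) /\ complex_eigenvalue J (0 -i* w)) /\
  (exists2 l : R, l < 0 & complex_eigenvalue J (l%:C)).

(* Main.v *)
(* The characteristic equation of the ring is (z-a1)(z-a2)(z-a3) = b1 b2 b3.
   Separating real and imaginary parts at z = iw shows that the second
   symmetric function q of the a_i is w^2 > 0 and that
   b1 b2 b3 = (a1+a2)(a1+a3)(a2+a3); the remaining eigenvalue is then the trace
   a1+a2+a3, which is negative.  If x+y >= 0 while x+y+z < 0, then
   z(x+y) <= -(x+y)^2, so xy+xz+yz <= -(x^2+xy+y^2) <= 0; hence q > 0 forces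
   every pairwise sum to be negative. *)

Require Import Defs.
From HB Require Import structures.
From mathcomp Require Import all_boot all_order all_algebra.
From mathcomp Require Import complex reals.
From mathcomp Require Import ring lra.

Import Order.TTheory GRing.Theory Num.Theory.
Local Open Scope ring_scope.

(** Carrying [x] once round the cycle returns it multiplied by [a * b * c], so only [x] is
    cancelled; [y] and [t] may vanish. *)
Lemma cyclic_elim (F : idomainType) (p q r a b c x y t : F) :
  p * x = c * t -> q * y = a * x -> r * t = b * y -> x != 0 ->
  p * q * r = a * b * c.
Proof.
move=> px qy rt x_neq0; apply: (mulIf x_neq0).
have -> : p * q * r * x = q * r * (p * x) by ring.
have -> : q * r * (p * x) = q * c * (r * t) by rewrite px; ring.
have -> : q * c * (r * t) = c * b * (q * y) by rewrite rt; ring.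
by rewrite qy; ring.
Qed.

Lemma ring3_char_eq (R : realType) (a1 a2 a3 b1 b2 b3 : R) (z : R[i]) :
  complex_eigenvalue (ring3_jacobian a1 a2 a3 b1 b2 b3) z ->
  (z - a1%:C%C) * (z - a2%:C%C) * (z - a3%:C%C) = b1%:C%C * b2%:C%C * b3%:C%C.
Proof.
move=> /eigenvalueP [v vJ v_neq0].
have lift1 : lift ord0 ord0 = 1 :> 'I_3 by apply/val_inj.
have lift2 : lift ord0 (lift ord0 ord0) = 2 :> 'I_3 by apply/val_inj.
(* Eigenvectors are rows here, so entry [j] of the eigen-equation reads column [j] of the matrix. *)
have col j := congr1 (fun u : 'rV_3 => u 0 j) vJ.
have := (col 0, col 1, col 2).
rewrite !mxE !big_ord_recl !big_ord0 !mxE /= !lift1 !lift2 => -[[]].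
rewrite !rmorph0 !mulr0 !addr0 !add0r => e0 e1 e2.
have ex : (z - a1%:C%C) * v 0 0 = b3%:C%C * v 0 2 by rewrite mulrBl -e0; ring.
have ey : (z - a2%:C%C) * v 0 1 = b1%:C%C * v 0 0 by rewrite mulrBl -e1; ring.
have et : (z - a3%:C%C) * v 0 2 = b2%:C%C * v 0 1 by rewrite mulrBl -e2; ring.
(* The relations are cyclically symmetric: the elimination starts at any nonzero coordinate. *)
have [x0|x_neq0] := eqVneq (v 0 0) 0; last exact: cyclic_elim ex ey et x_neq0.
have [y0|y_neq0] := eqVneq (v 0 1) 0; last first.
  rewrite -mulrA mulrC -[RHS]mulrA [RHS]mulrC.
  exact: cyclic_elim ey et ex y_neq0.
have [t0|t_neq0] := eqVneq (v 0 2) 0; last first.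
  by rewrite mulrC mulrA [RHS]mulrC [RHS]mulrA; apply: cyclic_elim et ex ey t_neq0.
case/eqP: v_neq0; apply/rowP => j; rewrite mxE.
case: (unliftP ord0 j) => [k ->|-> //].
case: (unliftP ord0 k) => [m ->|->]; last by rewrite lift1.
by rewrite (ord1 m) lift2.
Qed.

Lemma pair_sum_lt0 (R : realDomainType) (x y z : R) :
  x + y + z < 0 -> 0 < x * y + x * z + y * z -> x + y < 0.
Proof. by move=> s_lt0 q_gt0; rewrite ltNge; apply/negP => ?; nra. Qed.

Theorem lemma3p10 (R : realType) (a1 a2 a3 b1 b2 b3 : R)
    (hJ : hopf_from_stable (ring3_jacobian a1 a2 a3 b1 b2 b3)) :
  [/\ a1 + a2 < 0, a1 + a3 < 0, a2 + a3 < 0 & b1 * b2 * b3 < 0].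
Proof.
case: hJ => [[w w_neq0 [/ring3_char_eq eiw _]] [l l_lt0 /ring3_char_eq el]].
move: eiw el; simpc => -[re_iw im_iw] [el].
have w2_gt0 : 0 < w ^+ 2 by rewrite exprn_even_gt0.
have qE : a1 * a2 + a1 * a3 + a2 * a3 = w ^+ 2.
  by apply: (mulfI w_neq0); move: im_iw; lra.
have bE : b1 * b2 * b3 = (a1 + a2) * (a1 + a3) * (a2 + a3).
  transitivity ((a1 + a2 + a3) * w ^+ 2 - a1 * a2 * a3).
    by move: re_iw; lra.
  by rewrite -qE; ring.
have s_lt0 : a1 + a2 + a3 < 0.
  (* With s the trace, the characteristic equation at [l] factors as (l - s)(l^2 + w^2) = 0. *)
  have lw_neq0 : l ^+ 2 + w ^+ 2 != 0 by rewrite gt_eqF // ltr_wpDl ?sqr_ge0.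
  suff -> : a1 + a2 + a3 = l by [].
  apply: (mulIf lw_neq0); move: el; rewrite bE -qE => el; lra.
have q_gt0 : 0 < a1 * a2 + a1 * a3 + a2 * a3 by rewrite qE.
have h12 : a1 + a2 < 0 by apply: (@pair_sum_lt0 _ _ _ a3).
have h13 : a1 + a3 < 0 by apply: (@pair_sum_lt0 _ _ _ a2); lra.
have h23 : a2 + a3 < 0 by apply: (@pair_sum_lt0 _ _ _ a1); lra.
by split; rewrite // bE nmulr_llt0 // nmulr_lgt0.
Qed.
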